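(* Let $q\ge 4$ be a prime power, let $n=m(2,q)$ (that is, $n=q+2$ if $q$ is even and $n=q+1$ if $q$ is odd), and let $\mathcal{C}\leqslant\mathbb{F}_q^n$ be an $[n,3,n-2]_q$ MDS code. Let $\mathbf{G}\in\mathbb{F}_q^{3\times n}$ be a generator matrix of $\mathcal{C}$ such that 1) $\min\{|R| : R\in\mathcal{R}_i(\mathbf{G})\text{ for some }i\in\{1,2,3\}\}=2$, and 2) for every $i\in\{1,2,3\}$, $\{R\in\mathcal{R}_i(\mathbf{G}) : |R|=2\}$ is a partition of $[n]=\{1,\dots,n\}$. Then, encoding messages with $\mathbf{G}$, it is possible to correct any $t\le\lfloor\frac{n-2}{4}\rfloor$ errors with one-step majority-logic decoding (1S-MLD): there exist collections $\mathcal{T}_i\subseteq\mathcal{R}_i(\mathbf{G})$, $i\in\{1,2,3\}$, such that 1S-MLD using the $\mathcal{T}_i$'s as recovery groups corrects $t$ errors for every integer $0\le t\le\lfloor\frac{n-2}{4}\rfloor$.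
   Context: An $[n,k,d]_q$ code is a $k$-dimensional linear subspace of $\mathbb{F}_q^n$ with minimum Hamming distance $d$; it is MDS if $d+k=n+1$. For $\mathbf{G}=(\mathbf{g}_1\mid\dots\mid\mathbf{g}_n)\in\mathbb{F}_q^{k\times n}$ with columns $\mathbf{g}_j$, and $i\in[k]$, a recovery set for the $i$-th object (message symbol) is a set $J\subseteq[n]$ such that $\mathbf{e}_i\in\langle\mathbf{g}_j : j\in J\rangle$, where $\mathbf{e}_i$ is the $i$-th standard basis vector of $\mathbb{F}_q^k$. A recovery set for the $i$-th object is minimal if it does not properly contain another recovery set for the $i$-th object. $\mathcal{R}_i(\mathbf{G})$ denotes the collection of minimal recovery sets for the $i$-th object. Encoding: a message $\mathbf{m}=(m_1,\dots,m_k)^T\in\mathbb{F}_q^k$ is encoded as $\mathbf{c}^T=\mathbf{m}^T\mathbf{G}$. One-step majority-logic decoding (1S-MLD) of message symbols with recovery groups $\mathcal{T}_i\subseteq\mathcal{R}_i(\mathbf{G})$: for each $R\in\mathcal{T}_i$ there are unique coefficients $a^{(i,R)}_j\in\mathbb{F}_q$, $j\in R$, with $\mathbf{e}_i=\sum_{j\in R}a^{(i,R)}_j\mathbf{g}_j$; given a received word $\mathbf{y}\in\mathbb{F}_q^n$, the vote of $R$ for $m_i$ is $\sum_{j\in R}a^{(i,R)}_j y_j$, and the decoder outputs as $i$-th message symbol the value taken by a strict majority (more than half) of the votes of the $R\in\mathcal{T}_i$. The procedure corrects $t$ errors if for every message $\mathbf{m}$, every error vector $\mathbf{e}\in\mathbb{F}_q^n$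 of Hamming weight at most $t$, and every $i\in[k]$, more than half of the votes of the $R\in\mathcal{T}_i$ computed from $\mathbf{y}=\mathbf{c}+\mathbf{e}$ equal $m_i$. *)

(* Defs.v *)
From mathcomp Require Import all_boot all_order all_algebra.

Set Implicit Arguments.
Unset Strict Implicit.
Unset Printing Implicit Defensive.

Import GRing.Theory.
Local Open Scope ring_scope.

Definition is_minimum (P : nat -> Prop) (d : nat) : Prop :=
  P d /\ forall d' : nat, P d' -> (d <= d')%N.

Section Codes.

Variables (F : finFieldType) (n : nat).

Definition hamming_weight (x : 'rV[F]_n) : nat := #|[set j | x 0 j != 0]|.

Definition hamming_dist (x y : 'rV[F]_n) : nat := #|[set j | x 0 j != y 0 j]|.

Definition is_min_dist (C : {vspace 'rV[F]_n}) (d : nat) : Prop :=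
  is_minimum (fun d' => exists x y : 'rV[F]_n,
    [/\ x \in C, y \in C, x != y & hamming_dist x y = d']) d.

Definition is_code (C : {vspace 'rV[F]_n}) (k d : nat) : Prop :=
  \dim C = k /\ is_min_dist C d.

Definition is_MDS (C : {vspace 'rV[F]_n}) (k d : nat) : Prop :=
  is_code C k d /\ (d + k = n + 1)%N.

Variable k : nat.
Implicit Types (G : 'M[F]_(k, n)) (i : 'I_k) (J R : {set 'I_n}).

Definition is_generator_matrix G (C : {vspace 'rV[F]_n}) : bool :=
  basis_of C [seq row i G | i : 'I_k].

Definition std_basis i : 'cV[F]_k := delta_mx i 0.

Definition is_recovery_set G i J : bool :=
  std_basis i \in <<[seq col j G | j in J]>>%VS.

Definition min_recovery_sets G i : {set {set 'I_n}} :=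
  [set R | minset (is_recovery_set G i) R].

Definition is_recovery_coeff G i R (a : {ffun 'I_n -> F}) : bool :=
  (support a \subset R) && (std_basis i == \sum_(j in R) a j *: col j G).

(* The coefficients are extended by 0 outside R. They exist and are unique    *)
(* when R is a minimal recovery set (recovery_coeffP, recovery_coeff_uniq);   *)
(* the value for any other R is never used.                                   *)
Definition recovery_coeff G i R : {ffun 'I_n -> F} :=
  odflt 0 [pick a | is_recovery_coeff G i R a].

Definition encode G (m : 'cV[F]_k) : 'rV[F]_n := m^T *m G.

Definition vote G i R (y : 'rV[F]_n) : F :=
  \sum_(j in R) recovery_coeff G i R j * y 0 j.

Definition MLD_corrects G (T : 'I_k -> {set {set 'I_n}}) (t : nat) : Prop :=
  forall (m : 'cV[F]_k) (e : 'rV[F]_n), (hamming_weight e <= t)%N ->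
  forall i : 'I_k,
    let correct := [set R in T i | vote G i R (encode G m + e) == m i 0] in
    (#|T i| < 2 * #|correct|)%N.

Lemma is_recovery_setP G i J :
  reflect (exists a, is_recovery_coeff G i J a) (is_recovery_set G i J).
Proof.
apply: (iffP idP) => [|[a /andP[_ /eqP eq_a]]]; last first.
  rewrite /is_recovery_set eq_a; apply: memv_suml => j Jj.
  by apply/memvZ/memv_span/image_f.
rewrite /is_recovery_set span_def big_image /=.
move=> /memv_sumP[v v_in ev].
have cP j : {c : F | j \in J -> v j = c *: col j G}.
  have [Jj|_] := boolP (j \in J); last by exists 0.
  have: exists c : F, v j == c *: col j G.
    by have /vlineP[c ->] := v_in _ Jj; exists c.
  by case/sigW => c /eqP vj; exists c.
exists [ffun j => if j \in J then sval (cP j) else 0]; apply/andP; split.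
  by apply/subsetP=> j; rewrite inE /= ffunE; case: ifP => //; rewrite eqxx.
apply/eqP; rewrite ev; apply: eq_bigr => j Jj; rewrite ffunE.
by case: (cP j) => /= c; rewrite Jj => ->.
Qed.

Lemma recovery_coeffP G i R :
  R \in min_recovery_sets G i -> is_recovery_coeff G i R (recovery_coeff G i R).
Proof.
rewrite inE => /minsetp/is_recovery_setP[a Ha]; rewrite /recovery_coeff.
by case: pickP => [//|/(_ a)]; rewrite Ha.
Qed.

Lemma recovery_coeff_uniq G i R a :
  R \in min_recovery_sets G i -> is_recovery_coeff G i R a ->
  a = recovery_coeff G i R.
Proof.
move=> minR; move: (recovery_coeffP minR); move: (recovery_coeff G i R) => b.
move=> /andP[/subsetP sb /eqP eb] /andP[/subsetP sa /eqP ea].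
apply/eqP/negPn/negP => neq_ab.
have [j0 ab_j0]: exists j, a j != b j.
  apply/existsP; apply: contraNT neq_ab; rewrite negb_exists => /forallP eq_ab.
  by apply/eqP/ffunP=> j; apply/eqP/negPn/eq_ab.
have out (c : {ffun 'I_n -> F}) (sc : {subset support c <= R}) j :
    j \notin R -> c j = 0.
  by move=> Rj; apply/eqP; apply: contraNT Rj => cj; apply: sc.
have Rj0 : j0 \in R.
  by apply: contraNT ab_j0 => Rj; rewrite (out a sa) // (out b sb) // eqxx.
pose l := a j0 / (a j0 - b j0).
(* The combination c of a and b vanishes at j0, contradicting minimality.     *)
pose c := [ffun j => a j - l * (a j - b j)].
have c0 : c j0 = 0 by rewrite ffunE mulfVK ?subr_eq0 // subrr.
have ec : std_basis i = \sum_(j in R) c j *: col j G.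
  transitivity (\sum_(j in R) (a j *: col j G
      - (l *: (a j *: col j G) - l *: (b j *: col j G)))).
    by rewrite sumrB [X in _ - X]sumrB -!scaler_sumr -ea -eb subrr subr0.
  apply: eq_bigr => j _.
  by rewrite ffunE !scalerBl !scalerA mulrBr scalerBl.
have recc : is_recovery_set G i (R :\ j0).
  apply/is_recovery_setP; exists c; apply/andP; split.
    apply/subsetP=> j; rewrite !inE => cj.
    apply/andP; split; first by apply: contraNneq cj => ->; rewrite c0.
    apply: contraNT cj => Rj.
    by rewrite ffunE (out a sa) // (out b sb) // subrr mulr0 subr0.
  rewrite {1}ec (big_setD1 j0) //= c0 scale0r add0r eqxx //.
move: minR; rewrite inE => /minsetP[_ /(_ _ recc (subD1set R j0))] eqR.
by move: Rj0; rewrite -eqR !inE eqxx.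
Qed.

End Codes.

(* Main.v *)
(* The recovery sets of size 2 for a given symbol are n/2 pairwise disjoint   *)
(* sets, so t errors spoil at most t votes, and 2 t < n/2 as 4 t <= n - 2.    *)

Require Import Defs.
From mathcomp Require Import all_boot all_order all_algebra.
From mathcomp Require Import zify.

Import GRing.Theory.
Local Open Scope ring_scope.

(** A vote is linear in the received word, so a group that meets no error position votes correctly
    ([vote_error_free]). Pairwise disjoint groups cannot share an error position, hence wrong votes
    are at most as many as errors ([trivIset_meet_card]), and more than [2 * t] groups leave a
    correct majority ([MLD_corrects_disjoint]). The partition hypothesis supplies such groups: the
    pairs. *)

Lemma vote_error_free (F : finFieldType) (n k : nat) (G : 'M[F]_(k, n))
    (i : 'I_k) (R : {set 'I_n}) (m : 'cV[F]_k) (e : 'rV[F]_n) :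
  R \in min_recovery_sets G i -> {in R, forall j, e 0 j = 0} ->
  vote G i R (encode G m + e) = m i 0.
Proof.
move=> /recovery_coeffP/andP[_ /eqP ei] e0.
have -> : m i 0 = (m^T *m std_basis F i) 0 0 by rewrite -colE !mxE.
rewrite ei mulmx_sumr summxE; apply: eq_bigr => j Rj.
rewrite -scalemxAr !mxE e0 // addr0; congr (_ * _).
by apply: eq_bigr => l _; rewrite !mxE.
Qed.

(** Double counting: each block contributes at least one element of [S], and disjointness prevents
    any element from being counted twice. *)
Lemma trivIset_meet_card (T : finType) (P : {set {set T}}) (S : {set T}) :
  trivIset P -> (forall A, A \in P -> exists2 x, x \in A & x \in S) ->
  (#|P| <= #|S|)%N.
Proof.
move=> triv meet; rewrite -sum1_card.
apply: (@leq_trans (\sum_(A in P) \sum_(x in A) (x \in S))%N).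
  apply: leq_sum => A /meet[x Ax Sx].
  by rewrite (bigD1 x) //= Sx.
rewrite -big_trivIset // -sum1_card big_mkcond [leqRHS]big_mkcond /=.
by apply: leq_sum => x _; case: (x \in cover P); case: (x \in S).
Qed.

Lemma MLD_corrects_disjoint (F : finFieldType) (n k : nat) (G : 'M[F]_(k, n))
    (T : 'I_k -> {set {set 'I_n}}) (t : nat) :
  (forall i, T i \subset min_recovery_sets G i) ->
  (forall i, trivIset (T i)) -> (forall i, 2 * t < #|T i|)%N ->
  MLD_corrects G T t.
Proof.
move=> Tsub Ttriv Tbig m e wt_e i /=.
pose wrong := [set R in T i | vote G i R (encode G m + e) != m i 0].
have le_wrong : (#|wrong| <= t)%N.
  apply: leq_trans wt_e; apply: trivIset_meet_card.
    by apply: trivIsetS (Ttriv i); apply/subsetP => R /[!inE] /andP[].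
  move=> R /[!inE] /andP[TR badR].
  (* Contrapositive: if [R] avoids the support of [e], its vote is correct. *)
  apply/exists_inP; apply: contraNT badR => /exists_inPn e0.
  apply/eqP/vote_error_free; first exact: (subsetP (Tsub i)).
  by move=> j /e0 /[!inE] /negPn/eqP.
have := Tbig i.
rewrite -(cardsID [set R | vote G i R (encode G m + e) == m i 0] (T i)).
have -> : T i :\: [set R | vote G i R (encode G m + e) == m i 0] = wrong.
  by apply/setP => R; rewrite !inE andbC.
rewrite setIdE.
have arith a w : (w <= t -> 2 * t < a + w -> a + w < 2 * a)%N by lia.
exact: arith le_wrong.
Qed.

Theorem theorem18 (q : nat) (F : finFieldType) (cardF : #|F| = q)
    (q_ge4 : (4 <= q)%N)
    (n : nat) (n_def : n = (if odd q then q + 1 else q + 2)%N)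
    (C : {vspace 'rV[F]_n}) (C_MDS : is_MDS C 3 (n - 2))
    (G : 'M[F]_(3, n)) (G_gen : is_generator_matrix G C)
    (min_size : is_minimum (fun s => exists (i : 'I_3) (R : {set 'I_n}),
       R \in min_recovery_sets G i /\ #|R| = s) 2)
    (part : forall i : 'I_3,
       partition [set R in min_recovery_sets G i | #|R| == 2%N] [set: 'I_n]) :
  exists T : 'I_3 -> {set {set 'I_n}},
    (forall i : 'I_3, T i \subset min_recovery_sets G i) /\
    (forall t : nat, (t <= (n - 2) %/ 4)%N -> MLD_corrects G T t).
Proof.
pose T i := [set R in min_recovery_sets G i | #|R| == 2%N].
have Tsub i : T i \subset min_recovery_sets G i.
  by apply/subsetP => R /[!inE] /andP[].
exists T; split=> // t le_t; apply: MLD_corrects_disjoint => // i.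
  by case/and3P: (part i).
have := card_uniform_partition (n := 2) _ (part i).
rewrite cardsT card_ord => /(_ _) card_T.
have n_T : n = (#|T i| * 2)%N by apply: card_T => R /[!inE] /andP[_ /eqP].
(* As [n] is twice [#|T i|], [4 * t <= n - 2] gives [2 * t < #|T i|]; [n_def] makes [n] positive, so
   [n - 2] is not truncated. *)
by move: n_def le_t; case: (odd q); lia.
Qed.
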